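(* The level set $L(\frac12)$ of the Takagi function is countably infinite, with $L(\frac12)=\mathcal{L}_1\cup\mathcal{L}_2$, where $$\mathcal{L}_1=\Big\{x_k=\tfrac12-\sum_{j=1}^k\big(\tfrac14\big)^j: k=0,1,2,\ldots,\infty\Big\},\qquad \mathcal{L}_2=\{1-x: x\in\mathcal{L}_1\}.$$ It contains an infinite number of distinct local level sets. One has $L_{x_\infty}^{loc}=\{\frac16,\frac56\}\subset L(\frac12)$, and $\frac16\le x\le\frac56$ for all $x\in L(\frac12)$.
   Context: The Takagi function is $\tau(x)=\sum_{n=0}^\infty 2^{-n}\operatorname{dist}(2^n x,\mathbb{Z})$ for $x\in[0,1]$, where $\operatorname{dist}(t,\mathbb{Z})=\inf_{m\in\mathbb{Z}}|t-m|$. Convention: in level sets and local level sets, an element $x$ specifies a binary expansion $x=0.b_1b_2b_3\ldots=\sum_{j\ge1} b_j2^{-j}$ with $b_j\in\{0,1\}$; a dyadic rational in $(0,1)$ occurs twice, labelled by its two binary expansions. (The displayed description of $L(\frac12)$ is as a set of real numbers, each dyadic rational standing for both of its expansions.) The level set is $L(y)=\{x\in[0,1]:\tau(x)=y\}$. For a binary expansion $x=0.b_1b_2\ldots$ put $D_0(x)=0$ and $D_j(x)=j-2(b_1+\cdots+b_j)$ for $j\ge1$. The balance-set is $Z(x)=\{j\ge 0: D_j(x)=0\}=\{c_0<c_1<c_2<\cdots\}$ with $c_0=0$; if $Z(x)$ is finite with last element $c_n$, set $c_{n+1}=+\infty$. The $k$-th block $B_k(x)$ is the indexed string of digits $(b_j)_{c_k<j\le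 c_{k+1}}$ (all $j>c_k$ if $c_{k+1}=+\infty$). Two expansions are equivalent, $x\sim x'$, if $Z(x)=Z(x')$ and for each $k$ the block $B_k(x')$ either equals $B_k(x)$ or is obtained from it by flipping every digit ($b_j\mapsto 1-b_j$ for all $j$ in the block). The local level set of $x$ is $L_x^{loc}=\{x': x'\sim x\}$. *)

(* Defs.v *)
From HB Require Import structures.
From mathcomp Require Import all_boot all_order all_algebra.
From mathcomp Require Import all_classical all_reals all_analysis.

Set Implicit Arguments.
Unset Strict Implicit.
Unset Printing Implicit Defensive.

Import Order.TTheory GRing.Theory Num.Theory.
Import numFieldNormedType.Exports.

Local Open Scope classical_set_scope.
Local Open Scope ring_scope.

Definition distZ (R : realType) (t : R) : R :=
  inf [set `|t - m%:~R| | m in [set: int]].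

Definition takagi (R : realType) (x : R) : R :=
  limn (series (fun n : nat => distZ (2 ^+ n * x) / 2 ^+ n)).

(* A binary expansion 0.b_1b_2b_3..., stored with b_(i+1) at index i. Digits
   are always accessed through [digit e j], which is b_j for j >= 1. *)
Definition expansion := nat -> bool.

Definition digit (e : expansion) (j : nat) : bool := e j.-1.

Definition expval (R : realType) (e : expansion) : R :=
  limn (fun n : nat => \sum_(1 <= j < n.+1) (digit e j)%:R / 2 ^+ j : R).

Definition real_level_set (R : realType) (y : R) : set R :=
  [set x | 0 <= x <= 1 /\ takagi x = y].

(* The set of all binary expansions of elements of [A]: each dyadic rational of
   ]0, 1[ contributes its two expansions. *)
Definition expansions_of (R : realType) (A : set R) : set expansion :=
  [set e | A (expval R e)].

Definition level_set (R : realType) (y : R) : set expansion :=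
  expansions_of (real_level_set y).

Definition D (e : expansion) (j : nat) : int :=
  j%:Z - 2 * (\sum_(1 <= i < j.+1) digit e i)%N%:Z.

Definition balance_set (e : expansion) : set nat := [set j | D e j = 0].

(* [is_balance e k c] means c_k = c: the set Z(e) contains c and has exactly k
   elements below c. No c satisfies it when Z(e) has at most k elements, which
   covers the case where c_k is +oo. *)
Definition is_balance (e : expansion) (k c : nat) : Prop :=
  balance_set e c /\ #|[set i : 'I_c | D e i == 0]%SET| = k.

(* The positions j with c_k < j <= c_(k+1); empty when there is no k-th
   block. *)
Definition block_pos (e : expansion) (k : nat) : set nat :=
  [set j | (exists2 c, is_balance e k c & (c < j)%N) /\
           (forall c', is_balance e k.+1 c' -> (j <= c')%N)].

(* Once the balance-sets agree, both expansions have the same block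
   positions. *)
Definition equivalent (e e' : expansion) : Prop :=
  balance_set e = balance_set e' /\
  forall k,
    (forall j, block_pos e k j -> digit e' j = digit e j) \/
    (forall j, block_pos e k j -> digit e' j = ~~ digit e j).

Definition local_level_set (e : expansion) : set expansion :=
  [set e' | equivalent e e'].

Definition is_local_level_set (A : set expansion) : Prop :=
  exists e, A = local_level_set e.

Definition xk (R : realType) (k : nat) : R :=
  1 / 2 - \sum_(1 <= j < k.+1) (1 / 4) ^+ j.

Definition x_infty (R : realType) : R :=
  1 / 2 - limn (fun k : nat => \sum_(1 <= j < k.+1) (1 / 4 : R) ^+ j).

Definition L1 (R : realType) : set R := range (xk R) `|` [set x_infty R].

Arguments L1 : clear implicits.

Definition L2 (R : realType) : set R := [set 1 - x | x in L1 R].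

Arguments L2 : clear implicits.

(* Main.v *)
Require Import Defs.
From HB Require Import structures.
From mathcomp Require Import all_boot all_order all_algebra.
From mathcomp Require Import all_classical all_reals all_analysis.
From mathcomp Require Import ring lra zify.

Set Implicit Arguments.
Unset Strict Implicit.
Unset Printing Implicit Defensive.

Import Order.TTheory GRing.Theory Num.Theory.
Import numFieldNormedType.Exports.

Local Open Scope classical_set_scope.
Local Open Scope ring_scope.

(** The Takagi function satisfies [tau x = dist(x, Z) + tau (2 x) / 2].  Used
    twice on [0, 1/2], this gives [tau x = 2 x + tau (4 x) / 4] on [0, 1/4] and
    [tau x = 1/2 + tau (4 x - 1) / 4] on [1/4, 1/2].  Since [tau] vanishes on
    [0, 1] only at the endpoints, the second formula shows that 1/4 and 1/2 are
    the only solutions of [tau x = 1/2] in [1/4, 1/2].  On [0, 1/4] the first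
    formula and the symmetry [tau (1 - u) = tau u] turn [tau x = 1/2] into
    [tau v = 2 v] for [v = 1 - 4 x] ([level_half_left]).

    The solutions of [tau v = 2 v] are found by renormalization: any solution
    [v <> 0] gives the solution [4 v - 1], and conversely [w] gives
    [(1 + w) / 4].  The expanding map [v |-> 4 v - 1] fixes 1/3, so a solution
    that never reaches 0 stays at distance at most [4^-n] from 1/3 for every
    [n] and equals 1/3; the others are the points [1/3 - 4^-k / 3] of the
    backward orbit of 0 ([on_diagP]).  Going back to [x] gives
    [x_k = 1/6 + 4^-k / 3] and [x_infty = 1/6], hence the description of the
    real level set, its countability, and the bounds 1/6 and 5/6.

    A real number has at most countably many expansions, because an expansion
    that is not eventually constant is determined by its value
    ([expval_inj]); so the set of expansions is countable too.

    The expansion of 1/6 is 0.0010101..., whose walk [D] never returns to 0;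
    there is a single block and its local level set has two elements.  The
    expansion 0.0(01)^k 1000... of [x_(k+1)] has balance-set [{0, 2 k + 2}].
    Flipping its last block gives an expansion of [x_k], and the two remaining
    members of its local level set are the complements of these two, with values
    [1 - x_(k+1)] and [1 - x_k]; so the whole local level set lies in the level
    set.  The balance-sets differ, so these local level sets are pairwise
    distinct. *)

(** * Dyadically weighted sums *)

(** Both the Takagi function and the value of a binary expansion have this
    form with terms in [0, 1/2], so that convergence and the one-step recursion
    are proved once for both. *)
Definition binsum (R : realType) (h : nat -> R) : R :=
  limn (series (fun n => h n / 2 ^+ n)).

Lemma binsum_partialS (R : realType) (h : nat -> R) n :
  series (fun n => h n / 2 ^+ n) n.+1 =
  h 0%N + series (fun n => h n.+1 / 2 ^+ n) n / 2.
Proof.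
rewrite /series /= big_nat_recl// expr0 divr1 mulr_suml; congr (_ + _).
by apply: eq_bigr => i _; rewrite exprS invfM mulrA mulrAC.
Qed.

Lemma binsum_partial_le1 (R : realType) n (h : nat -> R) :
  (forall n, 0 <= h n <= 1 / 2) -> series (fun n => h n / 2 ^+ n) n <= 1.
Proof.
elim: n h => [|n IH] h hh; first by rewrite /series /= big_geq.
rewrite binsum_partialS.
have := IH (fun n => h n.+1) (fun n => hh n.+1); have := hh 0%N; lra.
Qed.

Lemma binsum_cvg (R : realType) (h : nat -> R) :
  (forall n, 0 <= h n <= 1 / 2) -> cvgn (series (fun n => h n / 2 ^+ n)).
Proof.
move=> hh; apply: nondecreasing_is_cvgn.
  apply: nondecreasing_series => n _ _.
  by rewrite divr_ge0 ?exprn_ge0//; case/andP: (hh n).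
by exists 1 => _ [n _ <-]; exact: binsum_partial_le1.
Qed.

Lemma binsum_bounds (R : realType) (h : nat -> R) :
  (forall n, 0 <= h n <= 1 / 2) -> 0 <= binsum h <= 1.
Proof.
move=> hh; apply/andP; split.
- apply: limr_ge; first exact: binsum_cvg.
  apply: nearW => n; apply: sumr_ge0 => i _.
  by rewrite divr_ge0 ?exprn_ge0//; case/andP: (hh i).
- apply: limr_le; first exact: binsum_cvg.
  by apply: nearW => n; exact: binsum_partial_le1.
Qed.

Lemma binsumE (R : realType) (h : nat -> R) :
  (forall n, 0 <= h n <= 1 / 2) ->
  binsum h = h 0%N + binsum (fun n => h n.+1) / 2.
Proof.
move=> hh; apply: cvg_lim => //; rewrite -cvg_shiftS.
rewrite (_ : [sequence _]_n = fun n =>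
    h 0%N + series (fun n => h n.+1 / 2 ^+ n) n / 2); last first.
  by apply/funext => n; exact: binsum_partialS.
apply: cvgD; first exact: cvg_cst.
by apply: cvgMr_tmp; apply: binsum_cvg => n.
Qed.

Lemma binsumD (R : realType) (h h' : nat -> R) :
  (forall n, 0 <= h n <= 1 / 2) -> (forall n, 0 <= h' n <= 1 / 2) ->
  binsum (fun n => h n + h' n) = binsum h + binsum h'.
Proof.
move=> hh hh'; rewrite /binsum -lim_seriesD; [|exact: binsum_cvg..].
by congr (limn (series _)); apply/funext => n /=; rewrite mulrDl.
Qed.

Lemma binsum_half (R : realType) : binsum (fun=> 1 / 2 : R) = 1.
Proof.
have h : forall n : nat, 0 <= (fun=> 1 / 2 : R) n <= 1 / 2 by move=> n /=; lra.
by have := binsumE h; move: {h} (binsum _) => s; lra.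
Qed.

(** * Distance to the integers and the Takagi function *)

Lemma distZDz (R : realType) (x : R) (m : int) : distZ (x + m%:~R) = distZ x.
Proof.
rewrite /distZ; congr inf; apply/seteqP; split => _ [k _ <-].
  by exists (k - m) => //; rewrite intrB; congr (`|_|); ring.
by exists (k + m) => //; rewrite intrD; congr (`|_|); ring.
Qed.

Lemma distZN (R : realType) (x : R) : distZ (- x) = distZ x.
Proof.
rewrite /distZ; congr inf; apply/seteqP; split => _ [k _ <-];
  exists (- k) => //; rewrite intrN -normrN; congr (`|_|); ring.
Qed.

Lemma distZ_id (R : realType) (x : R) : 0 <= x <= 1 / 2 -> distZ x = x.
Proof.
move=> hx; pose A := [set `|x - m%:~R| | m in [set: int]].
(* An integer at most 0 lies left of [x]; one at least 1 lies at distance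
   at least [1 - x >= x]. *)
have lbx : lbound A x.
  move=> _ [m _ <-]; have [m_le0|m_gt0] := leP m 0.
    have : (m%:~R : R) <= 0 by rewrite lerz0.
    by move=> ?; rewrite ger0_norm; lra.
  have : (1 : R) <= m%:~R by rewrite ler1z -gtz0_ge1.
  by move=> ?; rewrite ler0_norm; lra.
have Ax : A x by exists 0 => //; rewrite subr0 ger0_norm; lra.
apply/eqP; rewrite eq_le; apply/andP; split.
  by apply: ge_inf => //; exists x.
by apply: lb_le_inf => //; exists x.
Qed.

Lemma distZ_1B (R : realType) (x : R) : distZ (1 - x) = distZ x.
Proof. by rewrite addrC -[1]/(1%:~R) distZDz distZN. Qed.

Lemma distZ_bounds (R : realType) (x : R) : 0 <= distZ x <= 1 / 2.
Proof.
have /andP[flo_le lt_flo] := floor_itv x; rewrite intrD in lt_flo.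
rewrite -[x](subrK (Num.floor x)%:~R) distZDz.
set y := x - _; have hy : 0 <= y <= 1 by rewrite /y; lra.
have [y_le|y_gt] := lerP y (1 / 2); first by rewrite distZ_id; lra.
by rewrite -distZ_1B distZ_id; lra.
Qed.

Lemma takagi_binsum (R : realType) (x : R) :
  takagi x = binsum (fun n => distZ (2 ^+ n * x)).
Proof. by []. Qed.

Lemma takagi_bounds (R : realType) (x : R) : 0 <= takagi x <= 1.
Proof. by apply: binsum_bounds => n; exact: distZ_bounds. Qed.

Lemma takagiE (R : realType) (x : R) : takagi x = distZ x + takagi (2 * x) / 2.
Proof.
rewrite takagi_binsum binsumE; last by move=> n; exact: distZ_bounds.
rewrite expr0 mul1r takagi_binsum; congr (_ + binsum _ / 2).
by apply/funext => n; rewrite exprSr mulrA.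
Qed.

Lemma takagiD1 (R : realType) (x : R) : takagi (x + 1) = takagi x.
Proof.
rewrite !takagi_binsum; congr binsum; apply/funext => n.
by rewrite mulrDr mulr1 -(distZDz (2 ^+ n * x) (2 ^+ n)) rmorphXn.
Qed.

Lemma takagiN (R : realType) (x : R) : takagi (- x) = takagi x.
Proof.
rewrite !takagi_binsum; congr binsum; apply/funext => n.
by rewrite mulrN distZN.
Qed.

Lemma takagi_1B (R : realType) (x : R) : takagi (1 - x) = takagi x.
Proof. by rewrite addrC takagiD1 takagiN. Qed.

Lemma takagi0 (R : realType) : takagi 0 = 0 :> R.
Proof.
have := takagiE (0 : R); rewrite mulr0 distZ_id; last lra.
lra.
Qed.

Lemma takagi_eq0 (R : realType) (x : R) :
  0 <= x <= 1 -> takagi x = 0 -> x = 0 \/ x = 1.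
Proof.
move=> hx; rewrite takagiE; have := takagi_bounds (2 * x).
have [x_le|x_gt] := lerP x (1 / 2).
  by rewrite distZ_id => *; [left; lra | lra].
by rewrite -distZ_1B distZ_id => *; [right; lra | lra].
Qed.

(** Here both [x] and [2 x] are at most 1/2, so both distances are increasing
    and add up; on the next quarter the increase of the first is cancelled by
    the decrease of the second. *)
Lemma takagi_first_quarter (R : realType) (x : R) :
  0 <= x <= 1 / 4 -> takagi x = 2 * x + takagi (4 * x) / 4.
Proof.
move=> hx; rewrite takagiE [takagi (2 * x)]takagiE.
rewrite (_ : 2 * (2 * x) = 4 * x); last by ring.
rewrite !distZ_id; lra.
Qed.

Lemma takagi_second_quarter (R : realType) (x : R) :
  1 / 4 <= x <= 1 / 2 -> takagi x = 1 / 2 + takagi (4 * x - 1) / 4.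
Proof.
move=> hx; rewrite takagiE [takagi (2 * x)]takagiE -[distZ (2 * x)]distZ_1B.
rewrite -(takagiD1 (4 * x - 1)) subrK (_ : 2 * (2 * x) = 4 * x); last by ring.
rewrite !distZ_id; lra.
Qed.

(** * The points where tau v = 2 v *)

Definition on_diag (R : realType) (v : R) : Prop :=
  0 <= v <= 1 /\ takagi v = 2 * v.

Lemma on_diag_le_half (R : realType) (v : R) : on_diag v -> v <= 1 / 2.
Proof. by move=> [_ tv]; have := takagi_bounds v; lra. Qed.

Lemma on_diag0 (R : realType) : on_diag (0 : R).
Proof. by split; rewrite ?takagi0; lra. Qed.

Lemma on_diag_up (R : realType) (v : R) : on_diag v -> on_diag ((1 + v) / 4).
Proof.
move=> Sv; have := on_diag_le_half Sv; case: Sv => hv tv v_le.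
split; first lra.
rewrite takagi_second_quarter; last lra.
by rewrite (_ : 4 * ((1 + v) / 4) - 1 = v); [lra | field].
Qed.

(** Below 1/4 the linear part [2 v] already accounts for all of [tau v], which
    leaves [tau (4 v) = 0]: only 0 and 1/4 are possible, and 1/4 is sent
    to 0. *)
Lemma on_diag_down (R : realType) (v : R) :
  on_diag v -> v = 0 \/ on_diag (4 * v - 1).
Proof.
move=> Sv; have := on_diag_le_half Sv; case: Sv => hv tv v_le.
have [v_small|v_big] := lerP v (1 / 4); last first.
  right; split; first lra.
  by move: tv; rewrite takagi_second_quarter; lra.
have t4v : takagi (4 * v) = 0 by move: tv; rewrite takagi_first_quarter; lra.
have /(takagi_eq0)/(_ t4v)[v0|v1] : 0 <= 4 * v <= 1 by lra.
  by left; lra.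
by right; rewrite v1 subrr; exact: on_diag0.
Qed.

Lemma on_diag_third (R : realType) : on_diag (1 / 3 : R).
Proof.
split; first lra.
have h : 4 * (1 / 3) - 1 = 1 / 3 :> R by field.
have /takagi_second_quarter : 1 / 4 <= (1 / 3 : R) <= 1 / 2 by lra.
by rewrite h; lra.
Qed.

Lemma on_diag_orbit (R : realType) k : on_diag (1 / 3 - (1 / 4) ^+ k / 3 : R).
Proof.
elim: k => [|k /on_diag_up]; first by rewrite expr0 subrr; exact: on_diag0.
by congr on_diag; rewrite exprS; field.
Qed.

(** How the expanding map singles out its fixed point: an orbit that stays
    bounded started at distance 0 from it. *)
Lemma quarter_exp_eq0 (R : realType) (x : R) :
  (forall n, `|x| <= (1 / 4) ^+ n) -> x = 0.
Proof.
move=> hx; apply/normr0_eq0/eqP; rewrite eq_le normr_ge0 andbT.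
have cv : (GRing.exp (1 / 4 : R) : R^nat) @ \oo --> 0.
  by apply: cvg_expr; rewrite ger0_norm; lra.
rewrite -(cvg_lim _ cv)//; apply: limr_ge; first by apply/cvg_ex; exists 0.
exact: nearW.
Qed.

(** A solution is followed under [v |-> 4 v - 1]: either it reaches 0, and then
    it is one of the backward images of 0, or it never does, and then it is the
    fixed point 1/3. *)
Lemma on_diagP (R : realType) (v : R) :
  on_diag v <-> v = 1 / 3 \/ exists k, v = 1 / 3 - (1 / 4) ^+ k / 3.
Proof.
split; last first.
  by move=> [->|[k ->]]; [exact: on_diag_third | exact: on_diag_orbit].
move=> Sv; apply: contrapT => /not_orP[v_third v_orbit]; apply: v_third.
apply/subr0_eq/quarter_exp_eq0 => n.
elim: n v Sv v_orbit => [|n IH] v Sv v_orbit.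
  by case: Sv => hv _; rewrite expr0 ler_norml; lra.
case: (on_diag_down Sv) => [v0|Sw].
  by exfalso; apply: v_orbit; exists 0%N; rewrite v0 expr0; field.
have /(IH _ Sw) : ~ exists k, 4 * v - 1 = 1 / 3 - (1 / 4) ^+ k / 3.
  by move=> [k hk]; apply: v_orbit; exists k.+1; rewrite exprS; lra.
rewrite (_ : 4 * v - 1 - 1 / 3 = 4 * (v - 1 / 3)); last by field.
by rewrite normrM (ger0_norm (_ : 0 <= 4)) ?exprS//; lra.
Qed.

(** * The real level set *)

(** For [x <= 1/4], [tau x = 2 x + tau (1 - 4 x) / 4], so the value 1/2 is
    reached exactly when [tau (1 - 4 x) = 2 (1 - 4 x)]; for [x] in [1/4, 1/2]
    only the two endpoints remain. *)
Lemma level_half_left (R : realType) (x : R) : 0 <= x <= 1 / 2 ->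
  takagi x = 1 / 2 <-> x = 1 / 2 \/ on_diag (1 - 4 * x).
Proof.
move=> hx; split => [tx|[->|S4x]]; last 2 first.
- have /takagi_second_quarter -> : 1 / 4 <= (1 / 2 : R) <= 1 / 2 by lra.
  by rewrite (_ : 4 * (1 / 2) - 1 = 0 + 1) ?takagiD1 ?takagi0; [lra | field].
- have := on_diag_le_half S4x; case: S4x => h4x; rewrite takagi_1B => t4x x_ge.
  by rewrite takagi_first_quarter; lra.
have [x_small|x_big] := lerP x (1 / 4).
  right; split; first lra.
  by move: tx; rewrite takagi_1B takagi_first_quarter; lra.
have t0 : takagi (4 * x - 1) = 0.
  by move: tx; rewrite takagi_second_quarter; lra.
have /takagi_eq0/(_ t0)[w0|w1] : 0 <= 4 * x - 1 <= 1 by lra.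
  by exfalso; lra.
by left; lra.
Qed.

Lemma xkE (R : realType) k : xk R k = 1 / 6 + (1 / 4) ^+ k / 3.
Proof.
rewrite /xk; elim: k => [|k IH]; first by rewrite big_geq// expr0; field.
by rewrite big_nat_recr//= exprS; lra.
Qed.

Lemma x_inftyE (R : realType) : x_infty R = 1 / 6.
Proof.
rewrite /x_infty (_ : limn _ = 1 / 3 :> R); first by field.
apply: cvg_lim => //.
rewrite (_ : (fun k => _) = fun k => 1 / 3 - (1 / 4 : R) ^+ k / 3); last first.
  by apply/funext => k; have := xkE R k; rewrite /xk; lra.
rewrite -[X in _ --> X]subr0 -[X in _ - X](mul0r 3^-1).
apply: cvgB; first exact: cvg_cst.
apply: cvgMr_tmp; apply: cvg_expr; rewrite ger0_norm; lra.
Qed.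

(** The map [x |-> 1 - 4 x] sends [x_(k+1)] to [1/3 - 4^-k / 3] and [x_infty]
    to 1/3; the point [x_0 = 1/2] is the exceptional solution. *)
Lemma L1P (R : realType) (x : R) :
  L1 R x <-> 0 <= x <= 1 / 2 /\ takagi x = 1 / 2.
Proof.
have L1E : L1 R x <-> x = 1 / 2 \/ on_diag (1 - 4 * x).
  rewrite on_diagP; split.
  - move=> [[k _ <-]|->]; last by right; left; rewrite x_inftyE; field.
    case: k => [|k]; first by left; rewrite xkE expr0; field.
    by right; right; exists k; rewrite xkE exprS; field.
  - move=> [->|[x3|[k xk]]].
    + by left; exists 0%N => //; rewrite xkE expr0; field.
    + by right; rewrite /= x_inftyE; lra.
    + by left; exists k.+1 => //; rewrite xkE exprS; lra.
split=> [/L1E xP|[hx tx]]; last exact/L1E/level_half_left.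
suff hx : 0 <= x <= 1 / 2 by split => //; exact/level_half_left.
case: xP => [->|Sx]; first lra.
by have := on_diag_le_half Sx; case: Sx; lra.
Qed.

Lemma L1_ge (R : realType) (x : R) : L1 R x -> 1 / 6 <= x.
Proof.
move=> [[k _ <-]|->]; last by rewrite x_inftyE.
rewrite xkE lerDl divr_ge0// exprn_ge0//; lra.
Qed.

Lemma L2P (R : realType) (x : R) : L2 R x <-> L1 R (1 - x).
Proof.
split=> [[y Ly <-]|Lx]; first by rewrite subKr.
by exists (1 - x); rewrite ?subKr.
Qed.

Lemma level_half (R : realType) : real_level_set (1 / 2) = L1 R `|` L2 R.
Proof.
apply/seteqP; split => [x [hx tx]|x [/L1P[hx tx]|/L2P/L1P[hx]]].
- have [x_le|x_gt] := lerP x (1 / 2); first by left; apply/L1P; split => //; lra.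
  by right; apply/L2P/L1P; rewrite takagi_1B; split => //; lra.
- by split => //; lra.
- by rewrite takagi_1B; split => //; lra.
Qed.

Lemma xk_inj (R : realType) : injective (xk R).
Proof.
move=> m n; rewrite !xkE => h.
have {h} : (1 / 4 : R) ^+ m = (1 / 4) ^+ n by lra.
by apply: ieexprIn; rewrite ?lt_eqF//; lra.
Qed.

Lemma infinite_of_injection (T : Type) (A : set T) (f : nat -> T) :
  injective f -> (forall n, A (f n)) -> infinite_set A.
Proof.
move=> f_inj fA; apply: (@sub_infinite_set _ (range f)) => [_ [n _ <-]//|].
rewrite (eq_finite_set (inj_card_eq _)); first exact: infinite_nat.
by move=> m n _ _; exact: f_inj.
Qed.

(** * Values of binary expansions *)

Definition behead_exp (e : expansion) : expansion := fun i => e i.+1.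

Definition flip_exp (e : expansion) : expansion := fun i => ~~ e i.

Definition eventually_const (e : expansion) : Prop :=
  exists N c, forall i, (N <= i)%N -> e i = c.

Lemma bit_half_bounds (R : realType) (b : bool) : 0 <= (b%:R / 2 : R) <= 1 / 2.
Proof. by case: b => /=; lra. Qed.

Lemma expval_binsum (R : realType) (e : expansion) :
  expval R e = binsum (fun n => (e n)%:R / 2).
Proof.
rewrite /expval /binsum; congr (limn _); apply/funext => n.
rewrite /series /= big_add1; apply: eq_bigr => i _.
by rewrite exprS invfM mulrA.
Qed.

Lemma expvalE (R : realType) (e : expansion) :
  expval R e = (e 0%N)%:R / 2 + expval R (behead_exp e) / 2.
Proof.
by rewrite !expval_binsum binsumE// => n; exact: bit_half_bounds.
Qed.

Lemma expval_bounds (R : realType) (e : expansion) : 0 <= expval R e <= 1.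
Proof.
by rewrite expval_binsum; apply: binsum_bounds => n; exact: bit_half_bounds.
Qed.

Lemma flip_expK : involutive flip_exp.
Proof. by move=> e; apply/funext => i; rewrite /flip_exp negbK. Qed.

Lemma expval_flip (R : realType) (e : expansion) :
  expval R (flip_exp e) = 1 - expval R e.
Proof.
apply/eqP; rewrite eq_sym subr_eq; apply/eqP.
rewrite !expval_binsum -binsumD; [|by move=> n; exact: bit_half_bounds..].
rewrite -[LHS](binsum_half R); congr binsum; apply/funext => n.
by rewrite /flip_exp; case: (e n) => /=; field.
Qed.

Lemma expval_eq0 (R : realType) (e : expansion) :
  expval R e = 0 -> forall i, e i = false.
Proof.
move=> e0 i; elim: i e e0 => [|i IH] e;
  rewrite expvalE => e0; have := expval_bounds R (behead_exp e).
  by move: e0; case: (e 0%N) => //= e0; lra.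
move=> te_bounds; apply: (IH (behead_exp e)).
by move: e0; case: (e 0%N) => //= e0; lra.
Qed.

Lemma expval_eq1 (R : realType) (e : expansion) :
  expval R e = 1 -> forall i, e i = true.
Proof.
move=> e1 i; apply/negbFE; apply: (@expval_eq0 R (flip_exp e)).
by rewrite expval_flip e1 subrr.
Qed.

(** If the first digits differ, then equality of the values forces the tails to
    have the extreme values 0 and 1, so all their digits are equal. *)
Lemma expval_head (R : realType) (e e' : expansion) :
  expval R e = expval R e' -> ~ eventually_const e ->
  e 0%N = e' 0%N /\ expval R (behead_exp e) = expval R (behead_exp e').
Proof.
move=> ee' e_nc; have := ee'; rewrite (expvalE _ e) (expvalE _ e').
have := expval_bounds R (behead_exp e); have := expval_bounds R (behead_exp e').
have tail c : (forall i, behead_exp e i = c) -> eventually_const e.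
  by move=> te; exists 1%N, c; case=> // i _; exact: te.
case: (e 0%N); case: (e' 0%N) => /= te'_b te_b te; first by split => //; lra.
- by exfalso; apply/e_nc/(tail false)/(@expval_eq0 R); lra.
- by exfalso; apply/e_nc/(tail true)/(@expval_eq1 R); lra.
- by split => //; lra.
Qed.

Lemma expval_inj (R : realType) (e e' : expansion) :
  expval R e = expval R e' -> ~ eventually_const e -> e = e'.
Proof.
move=> ee' e_nc; apply/funext => n.
elim: n e e' ee' e_nc => [|n IH] e e' ee' e_nc;
  have [hd tl] := expval_head ee' e_nc => //.
apply: (IH _ _ tl) => -[N [c te]]; apply: e_nc.
by exists N.+1, c; case=> // i; exact: te.
Qed.

Lemma eventually_const_countable : countable eventually_const.
Proof.
(* The finite prefix with the eventual digit as default value is a code. *)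
pose of_code (sc : seq bool * bool) : expansion := nth sc.2 sc.1.
have sub : eventually_const `<=` range of_code.
  move=> e [N [c ec]]; exists (mkseq e N, c) => //; apply/funext => i.
  have [iN|Ni] := ltnP i N; first by rewrite /of_code /= nth_mkseq.
  by rewrite /of_code /= nth_default ?size_mkseq// ec.
apply: sub_countable (subset_card_le sub) _.
exact: sub_countable (card_image_le _ _) (countableP _).
Qed.

(** In each fibre of [expval] either all expansions are eventually constant, or
    one is not and it is then alone. *)
Lemma expansions_of_countable (R : realType) (A : set R) :
  countable A -> countable (expansions_of A).
Proof.
move=> cA; pose fiber (x : R) := [set e | expval R e = x].
have -> : expansions_of A = \bigcup_(x in A) fiber x.
  apply/seteqP; split => [e Ae|e [x Ax ex]].
  exact: (ex_intro2 _ _ (expval R e) Ae erefl).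
  by rewrite /expansions_of /= ex.
apply: bigcup_countable => // x _.
have [[e [ex e_nc]]|no_nc] := pselect (exists e, fiber x e /\ ~ eventually_const e).
  have sub : fiber x `<=` [set e].
    by move=> e' e'x; apply/esym/(@expval_inj R) => //; rewrite [LHS]ex.
  exact: sub_countable (subset_card_le sub) (countable1 e).
apply: sub_countable eventually_const_countable; apply: subset_card_le => e ex.
by apply: contrapT => e_nc; apply: no_nc; exists e.
Qed.

(** * Balance-sets with one or two elements *)

Lemma D0 (e : expansion) : D e 0 = 0.
Proof. by rewrite /D big_geq// mulr0 subrr. Qed.

Lemma is_balance0 (e : expansion) : is_balance e 0 0.
Proof. by split; [exact: D0 | rewrite -[RHS]card_ord; apply: eq_card; case]. Qed.

Lemma is_balance_fun (e : expansion) k k' c :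
  is_balance e k c -> is_balance e k' c -> k = k'.
Proof. by move=> [_ <-] [_ <-]. Qed.

Lemma is_balance1 (e : expansion) c :
  balance_set e = [set 0%N; c] -> (0 < c)%N -> is_balance e 1 c.
Proof.
move=> Ze c_gt0; split; first by rewrite Ze; right.
rewrite (_ : [set i : 'I_c | _]%SET = [set Ordinal c_gt0]%SET) ?cards1//.
apply/setP => i; rewrite !inE; apply/eqP/eqP => [Dei|->]; last exact: D0.
have : balance_set e i by [].
by rewrite Ze => -[i0|ic]; [exact: val_inj | have := ltn_ord i; rewrite ic ltnn].
Qed.

Lemma D_flip (e : expansion) j : D (flip_exp e) j = - D e j.
Proof.
suff : ((\sum_(1 <= i < j.+1) digit (flip_exp e) i) +
        (\sum_(1 <= i < j.+1) digit e i) = j)%N by rewrite /D; lia.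
rewrite -big_split /= (eq_bigr (fun=> 1%N)); last first.
  by move=> i _; rewrite /digit /flip_exp; case: (e _).
by rewrite sum_nat_const_nat subn1 muln1.
Qed.

Lemma equivalent_refl (e : expansion) : equivalent e e.
Proof. by split=> // k; left. Qed.

Lemma equivalent_flip (e : expansion) : equivalent e (flip_exp e).
Proof.
split; last by move=> k; right.
by apply/seteqP; split => j; rewrite /balance_set /= D_flip; lia.
Qed.

Lemma local_level_set_one_block (e : expansion) :
  balance_set e = [set 0%N] -> local_level_set e = [set e; flip_exp e].
Proof.
move=> Ze; apply/seteqP; split => [e' [_ /(_ 0%N)]|e' [->|->]]; last 2 first.
- exact: equivalent_refl.
- exact: equivalent_flip.
have blk i : block_pos e 0 i.+1.
  split; first by exists 0%N => //; exact: is_balance0.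
  move=> c' ec'; have [] := ec'; rewrite Ze => c'0 _.
  by move: ec'; rewrite c'0 => /(is_balance_fun (is_balance0 e)).
by case=> e'E; [left|right]; apply/funext => i; have := e'E _ (blk i).
Qed.

(** The general member of a local level set whose only balance points are 0
    and [c]: [a] and [b] tell whether the first and the last block are
    flipped. *)
Definition flip_blocks (c : nat) (a b : bool) (e : expansion) : expansion :=
  fun i => e i (+) (if (i < c)%N then a else b).

(** Every position up to [c] is in block 0 and every later one in block 1, so
    the equivalence provides one flip for each of the two ranges. *)
Lemma local_level_set_two_blocks (e e' : expansion) c :
  balance_set e = [set 0%N; c] -> (0 < c)%N -> local_level_set e e' ->
  exists a b, e' = flip_blocks c a b e.
Proof.
move=> Ze c_gt0 [_ ee'].
have Zk k c' : is_balance e k c' -> c' = 0%N /\ k = 0%N \/ c' = c /\ k = 1%N.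
  move=> ec'; have [] := ec'; rewrite Ze => -[] c'E _; [left|right]; split=> //.
    by apply: is_balance_fun ec' _; rewrite c'E; exact: is_balance0.
  by apply: is_balance_fun ec' _; rewrite c'E; exact: is_balance1.
have blk0 i : (i < c)%N -> block_pos e 0 i.+1.
  move=> ic; split; first by exists 0%N => //; exact: is_balance0.
  by move=> c' /Zk[[]|[->]].
have blk1 i : (c <= i)%N -> block_pos e 1 i.+1.
  move=> ci; split; first by exists c => //; exact: is_balance1.
  by move=> c' /Zk[[]|[]].
have [a e'a] : exists a, forall i, (i < c)%N -> e' i = e i (+) a.
  by have [h|h] := ee' 0%N; [exists false|exists true] => i /blk0/h;
    rewrite /digit /= => ->; rewrite ?addbF ?addbT.
have [b e'b] : exists b, forall i, (c <= i)%N -> e' i = e i (+) b.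
  by have [h|h] := ee' 1%N; [exists false|exists true] => i /blk1/h;
    rewrite /digit /= => ->; rewrite ?addbF ?addbT.
exists a, b; apply/funext => i; rewrite /flip_blocks.
by case: ltnP => [/e'a|/e'b].
Qed.

(** * The expansions of 1/6 and of the points x_(k+1) *)

(** 0.00101010..., with digit [b_(i+1)] at index [i]. *)
Definition zigzag : expansion := fun i => ~~ odd i && (0 < i)%N.

(** 0.0(01)^k 1000...: one more digit 1 at index [2 k + 1], that is
    [b_(2k+2)], brings the walk back to 0, and it then increases forever. *)
Definition zigzag_stop (k : nat) : expansion :=
  fun i => if (i < k.*2.+1)%N then zigzag i else i == k.*2.+1.

Lemma ones_zigzag j : (\sum_(1 <= i < j.+1) digit zigzag i)%N = j.-1./2.
Proof.
elim: j => [|j IH]; first by rewrite big_geq.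
by rewrite big_nat_recr//= IH /digit /zigzag /=; lia.
Qed.

Lemma balance_set_zigzag : balance_set zigzag = [set 0%N].
Proof.
apply/seteqP; split=> [j|_ ->]; last exact: D0.
by rewrite /balance_set /D /= ones_zigzag; lia.
Qed.

Lemma ones_zigzag_stop k j : (\sum_(1 <= i < j.+1) digit (zigzag_stop k) i)%N =
  if (j < k.*2.+2)%N then j.-1./2 else k.+1.
Proof.
elim: j => [|j IH]; first by rewrite big_geq.
rewrite big_nat_recr//= IH /digit /zigzag_stop /zigzag /=.
by case: ifP; case: ifP; case: ifP => *; lia.
Qed.

Lemma balance_set_zigzag_stop k :
  balance_set (zigzag_stop k) = [set 0%N; k.*2.+2].
Proof.
apply/seteqP; split=> [j|_ [|]->]; last 2 first.
- exact: D0.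
- by rewrite /balance_set /D /= ones_zigzag_stop ltnn; lia.
rewrite /balance_set /D /= ones_zigzag_stop.
by case: ltnP => ? ?; [left|right]; lia.
Qed.

Lemma zigzag_not_eventually_const : ~ eventually_const zigzag.
Proof.
move=> [N [c ec]]; have := ec N.*2.+2; have := ec N.*2.+3.
by rewrite /zigzag /= odd_double /= => <-; [move/(_ _)|]; lia.
Qed.

(** Dropping three digits has the same effect as dropping one, which yields a
    linear equation for the value. *)
Lemma expval_zigzag (R : realType) : expval R zigzag = 1 / 6.
Proof.
have zz : behead_exp (behead_exp (behead_exp zigzag)) = behead_exp zigzag.
  by apply/funext => i; rewrite /behead_exp /zigzag /= negbK.
have := expvalE R zigzag; have := expvalE R (behead_exp zigzag).
have := expvalE R (behead_exp (behead_exp zigzag)).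
rewrite zz /behead_exp /zigzag /=; lra.
Qed.

Lemma expval_const (R : realType) (b : bool) : expval R (fun=> b) = b%:R.
Proof. have := expvalE R (fun=> b); rewrite /behead_exp; lra. Qed.

(** A tail of ones after position [2 k + 2] adds [4^-(k+1)], which turns
    [x_(k+1)] into [x_k].  The induction drops the first three digits: as in
    [zigzag], this is what removes one period. *)
Lemma expval_zigzag_stop (R : realType) k (b : bool) :
  expval R (flip_blocks k.*2.+2 false b (zigzag_stop k)) =
  xk R (if b then k else k.+1).
Proof.
rewrite !xkE; elim: k => [|k IH].
  set e := flip_blocks _ _ _ _.
  have te : behead_exp (behead_exp e) = fun=> b.
    by apply/funext => i; rewrite /e /behead_exp /flip_blocks /zigzag_stop.
  have := expvalE R e; have := expvalE R (behead_exp e).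
  rewrite te expval_const /e /behead_exp /flip_blocks /zigzag_stop /=.
  by clear te e; case: b => /=; rewrite ?expr1 ?expr0; lra.
move: IH; set e := flip_blocks _ _ _ (zigzag_stop k) => IH.
set e' := flip_blocks _ _ _ _.
have te : behead_exp (behead_exp (behead_exp e')) = behead_exp e.
  apply/funext => i.
  rewrite /e /e' /behead_exp /flip_blocks /zigzag_stop /zigzag.
  by rewrite doubleS !ltnS !eqSS /= !negbK.
have := expvalE R e'; have := expvalE R (behead_exp e').
have := expvalE R (behead_exp (behead_exp e')); have := expvalE R e.
rewrite te {}IH /behead_exp /e' /e /flip_blocks /zigzag_stop /zigzag /=.
by clear te e e'; case: b; rewrite !exprS /=; lra.
Qed.

(** * Local level sets inside the level set, and cardinality *)

Lemma real_level_set_1B (R : realType) (y x : R) :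
  real_level_set y x -> real_level_set y (1 - x).
Proof. by move=> [hx tx]; split; [lra | rewrite takagi_1B]. Qed.

Lemma xk_level (R : realType) k : real_level_set (1 / 2) (xk R k).
Proof. by rewrite level_half; left; left; exists k. Qed.

(** Up to the symmetry [x |-> 1 - x] the first block may be assumed
    unflipped; the value is then [x_k] or [x_(k+1)]. *)
Lemma local_zigzag_stop_sub_level (R : realType) k :
  local_level_set (zigzag_stop k) `<=` level_set (1 / 2 : R).
Proof.
move=> e' /(local_level_set_two_blocks (balance_set_zigzag_stop k)).
case=> // a [b ->]; rewrite /level_set /expansions_of /=.
have level_false c : real_level_set (1 / 2)
    (expval R (flip_blocks k.*2.+2 false c (zigzag_stop k))).
  by rewrite expval_zigzag_stop; exact: xk_level.
case: a; last exact: level_false.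
have -> : flip_blocks k.*2.+2 true b (zigzag_stop k) =
    flip_exp (flip_blocks k.*2.+2 false (~~ b) (zigzag_stop k)).
  apply/funext => i; rewrite /flip_exp /flip_blocks.
  by case: ifP; case: (zigzag_stop k i); case: b.
by rewrite expval_flip; exact: real_level_set_1B.
Qed.

(** A local level set determines the common balance-set of its members. *)
Lemma local_zigzag_stop_inj :
  injective (fun k => local_level_set (zigzag_stop k)).
Proof.
move=> m n mn; have [Zmn _] : local_level_set (zigzag_stop m) (zigzag_stop n).
  by rewrite mn; exact: equivalent_refl.
have : balance_set (zigzag_stop n) m.*2.+2.
  by rewrite -Zmn balance_set_zigzag_stop; right.
by rewrite balance_set_zigzag_stop => -[|/= ?] //; lia.
Qed.

Lemma expansions_of_sixths (R : realType) :
  expansions_of [set (1 / 6 : R); 5 / 6] = [set zigzag; flip_exp zigzag].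
Proof.
have zigzag_uniq e : expval R e = 1 / 6 -> e = zigzag.
  rewrite -expval_zigzag => /esym/expval_inj ->//.
  exact: zigzag_not_eventually_const.
apply/seteqP; split=> [e [/zigzag_uniq ->|e56]|e [->|->]].
- by left.
- right; rewrite /= -(flip_expK e); congr flip_exp; apply: zigzag_uniq.
  by rewrite expval_flip [expval R e]e56; field.
- by left; exact: expval_zigzag.
- by right; rewrite expval_flip expval_zigzag; field.
Qed.

Lemma real_level_half_countable (R : realType) :
  countable (real_level_set (1 / 2 : R)).
Proof.
have c1 : countable (L1 R).
  rewrite /L1 -bigcup2E; apply: bigcup_countable => // -[|[|i]] _ /=.
  - exact: sub_countable (card_image_le _ _) (countableP _).
  - exact: countable1.
  - exact: countable0.
rewrite level_half -bigcup2E; apply: bigcup_countable => // -[|[|i]] _ //=.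
exact: sub_countable (card_image_le _ _) c1.
Qed.

Theorem theorem7p1 (R : realType) :
  (real_level_set (1 / 2 : R) #= [set: nat])%card /\
  (level_set (1 / 2 : R) #= [set: nat])%card /\
  real_level_set (1 / 2 : R) = L1 R `|` L2 R /\
  infinite_set [set A | is_local_level_set A /\ A `<=` level_set (1 / 2 : R)] /\
  (exists e, expval R e = x_infty R) /\
  (forall e, expval R e = x_infty R ->
     local_level_set e = expansions_of [set (1 / 6 : R); 5 / 6]) /\
  (forall e, expval R e = x_infty R ->
     [set expval R e' | e' in local_level_set e] = [set (1 / 6 : R); 5 / 6]) /\
  [set (1 / 6 : R); 5 / 6] `<=` real_level_set (1 / 2 : R) /\
  (forall x : R, real_level_set (1 / 2) x -> 1 / 6 <= x <= 5 / 6).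
Proof.
have local_zigzag (e : expansion) : expval R e = x_infty R ->
    local_level_set e = [set zigzag; flip_exp zigzag].
  rewrite x_inftyE -expval_zigzag => /esym/expval_inj <-.
    exact: local_level_set_one_block balance_set_zigzag.
  exact: zigzag_not_eventually_const.
have level_sixth : real_level_set (1 / 2 : R) (1 / 6).
  by rewrite level_half; left; right; rewrite /= x_inftyE.
split.
  apply: eq_card_nat; first exact: real_level_half_countable.
  exact: infinite_of_injection (@xk_inj R) (@xk_level R).
split.
  apply: eq_card_nat.
    exact/expansions_of_countable/real_level_half_countable.
  have zs_inj : injective zigzag_stop.
    by move=> m n mn; apply: local_zigzag_stop_inj => /=; rewrite mn.
  apply: infinite_of_injection zs_inj _ => k.
  exact/local_zigzag_stop_sub_level/equivalent_refl.
split; first exact: level_half.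
split.
  apply: infinite_of_injection local_zigzag_stop_inj _ => k.
  by split; [exists (zigzag_stop k) | exact: local_zigzag_stop_sub_level].
split; first by exists zigzag; rewrite x_inftyE expval_zigzag.
split; first by move=> e /local_zigzag ->; rewrite expansions_of_sixths.
split.
  move=> e /local_zigzag ->; rewrite image_setU !image_set1.
  by rewrite expval_flip expval_zigzag; congr (_ `|` [set _]); field.
split.
  move=> _ [->|->] //; rewrite (_ : 5 / 6 = 1 - 1 / 6 :> R); last by field.
  exact: real_level_set_1B.
rewrite level_half => x [Lx|/L2P Lx]; have := L1_ge Lx.
  by case/L1P: Lx; lra.
by case/L1P: Lx; lra.
Qed.
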